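(* If $n\ge4$ and $d\ge3$, then for every integer $a\ge 0$, \begin{align*} c(n,d,a)={}&c(n-1,d-1,a-1)+2c(n-2,d,a)+c(n-2,d-1,a-1)+c(n-3,d-2,a)\\ &-c(n-3,d-1,a-1)-c(n-3,d-2,a-2)-c(n-4,d,a)-c(n-4,d-1,a-1). \end{align*}
   Context: A composition of a positive integer $n$ with $d$ parts is a sequence $\sigma_1\sigma_2\cdots\sigma_d$ of positive integers with $\sigma_1+\cdots+\sigma_d=n$. By convention there is a single composition of $0$, having zero parts. A parity succession in a composition is an index $i$ with $1\le i\le d-1$ and $\sigma_{i+1}\equiv\sigma_i\pmod 2$. The number $c(n,d,a)$ is the number of compositions of $n$ with exactly $d$ parts containing exactly $a$ parity successions; in particular $c(n,d,a)=0$ if $a<0$ or if $d>n$. *)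

(* Defs.v *)
From mathcomp Require Import all_boot all_order all_algebra.
Set Implicit Arguments.
Unset Strict Implicit.
Unset Printing Implicit Defensive.

Definition is_composition (n : nat) (s : seq nat) : bool :=
  all (fun x => 0 < x) s && (sumn s == n).

(* Parts are indexed from 0, so a succession is an index i with
   i + 1 < size s at which parts i and i + 1 have the same parity. *)
Definition parity_successions (s : seq nat) : nat :=
  count (fun i => nth 0 s i.+1 == nth 0 s i %[mod 2]) (iota 0 (size s).-1).

(* No part of a composition of n exceeds n, so ranging over tuples with
   entries in 'I_n.+1 loses nothing and makes the count finite. The number
   of successions is an integer a, so that c n d a = 0 for a < 0. *)
Definition c (n d : nat) (a : int) : nat :=
  #|[set s : d.-tuple 'I_n.+1 |
      let p := map val s in
      is_composition n p && ((parity_successions p)%:Z == a)%R]|.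

(* Main.v *)
(** Let O(n,d,a) and E(n,d,a) count the compositions whose first part is odd,
resp. even. Either the first part is at least 3, and lowering it by 2 changes
no succession, or it is 1 or 2 and may be deleted. Hence, for n >= 2 and d >= 2,
<<
  O(n,d,a) = O(n-2,d,a) + O(n-1,d-1,a-1) + E(n-1,d-1,a)
  E(n,d,a) = E(n-2,d,a) + E(n-2,d-1,a-1) + O(n-2,d-1,a)
>>
and the recurrence for c = O + E is an integer linear combination of instances
of these two. *)
Require Import Defs.
From mathcomp Require Import all_boot all_order all_algebra.
From mathcomp Require Import zify.

(** Enumerating by first part turns recursions on that part into list computations, which the set of
    tuples defining [c] does not offer directly. *)
Fixpoint compositions (n d : nat) : seq (seq nat) :=
  if d is d'.+1 then
    [seq x :: s | x <- iota 1 n, s <- compositions (n - x) d']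
  else if n == 0 then [:: [::]] else [::].

Lemma mem_compositions (n d : nat) (s : seq nat) :
  (s \in compositions n d) = is_composition n s && (size s == d).
Proof.
elim: d n s => [|d IH] n s /=.
  case: s => [|x s] /=; last by rewrite andbF; case: (n == 0).
  by rewrite /is_composition /= andbT eq_sym; case: eqVneq.
apply/flatten_mapP/idP => [[x xn /mapP[t tn ->]]|].
  move: xn tn; rewrite mem_iota IH /is_composition /= eqSS.
  by move=> xn /andP[/andP[-> /eqP t_sum] ->]; rewrite !andbT t_sum; lia.
case: s => [|x t]; first by rewrite andbF.
rewrite /is_composition /= eqSS => /andP[/andP[/andP[x0 tpos] /eqP sn] td].
exists x; first by rewrite mem_iota; lia.
by apply: map_f; rewrite IH /is_composition tpos td -sn addKn eqxx.
Qed.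

Lemma compositions_uniq (n d : nat) : uniq (compositions n d).
Proof.
elim: d n => [|d IH] n /=; first by case: (n == 0).
apply: allpairs_uniq_dep => [|x _|]; [exact: iota_uniq | exact: IH |].
by move=> [x s] [y t] _ _ /= [-> ->].
Qed.

Lemma c_count (n d : nat) (a : int) :
  c n d a = count (fun s => (parity_successions s)%:Z == a)%R (compositions n d).
Proof.
rewrite /c cardE -size_filter.
set A := [set s | _].
pose f (s : d.-tuple 'I_n.+1) : seq nat := map val s.
rewrite -(size_map f); apply: perm_size; apply: uniq_perm.
- rewrite map_inj_uniq ?enum_uniq // => s t /(inj_map val_inj) st.
  exact: val_inj.
- exact/filter_uniq/compositions_uniq.
move=> s; rewrite mem_filter mem_compositions.
apply/mapP/idP => [[t]|].
  rewrite mem_enum inE => /andP[tn ta] ->.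
  by rewrite ta tn size_map size_tuple eqxx.
move=> /andP[sa /andP[sn sd]].
have s_le x : x \in s -> x <= n.
  case/andP: sn => _ /eqP <- xs.
  by rewrite sumnE (big_rem x xs) leq_addr.
(* Each part is at most [n], so [inord] keeps its value and the list lifts to a tuple over
   ['I_n.+1]. *)
have valK : map val (map (@inord n) s) = s.
  rewrite -map_comp -[RHS]map_id; apply/eq_in_map => x xs /=.
  by rewrite inordK // ltnS s_le.
have size_t : size (map (@inord n) s) == d by rewrite size_map.
exists (Tuple size_t) => //.
by rewrite mem_enum inE /= valK sn.
Qed.

Lemma count_compositions (P : pred (seq nat)) (n d : nat) :
  count P (compositions n d.+1) =
  sumn [seq count (fun s => P (x :: s)) (compositions (n - x) d) | x <- iota 1 n].
Proof.
rewrite /= count_flatten -map_comp; congr sumn.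
by apply: eq_map => x /=; rewrite count_map.
Qed.

Lemma count_compositions_add2 (P : pred (seq nat)) (n d : nat) :
  (forall x s, P (x.+2 :: s) = P (x :: s)) ->
  count P (compositions n.+2 d.+1) =
  count (fun s => P (1 :: s)) (compositions n.+1 d)
  + count (fun s => P (2 :: s)) (compositions n d)
  + count P (compositions n d.+1).
Proof.
move=> P2; rewrite !count_compositions /= subn1 subn2 /= -addnA.
congr (_ + (_ + sumn _)).
(* The first parts 3, ..., n + 2 are 1, ..., n shifted by 2, with the same remainder left for the
   tail. *)
rewrite -[iota 3 n]/(iota (2 + 1) n) iotaDl -map_comp.
by apply: eq_map => x /=; rewrite !subSS; apply: eq_count => s; apply: P2.
Qed.

Lemma parity_successions_cons2 (x y : nat) (s : seq nat) :
  parity_successions [:: x, y & s] =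
  (odd x == odd y) + parity_successions (y :: s).
Proof.
rewrite /parity_successions /= -[iota 1 _]/(iota (1 + 0) _) iotaDl count_map.
by rewrite !modn2 eq_sym; case: (odd x); case: (odd y).
Qed.

(** The default 0 of [head] files the empty composition under even first part, so the two parities
    still cover everything when [d] is 0. *)
Definition succs_from (b : bool) (a : int) (s : seq nat) : bool :=
  (odd (head 0 s) == b) && ((parity_successions s)%:Z == a)%R.

Definition count_from (b : bool) (n d : nat) (a : int) : nat :=
  count (succs_from b a) (compositions n d).

Lemma count_by_head (P : pred (seq nat)) (b : bool) (l : seq (seq nat)) :
  count P l = count (fun s => (odd (head 0 s) == b) && P s) l
            + count (fun s => (odd (head 0 s) == ~~ b) && P s) l.
Proof.
by elim: l => //= s l ->; case: (odd _); case: b; case: (P s) => /=; lia.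
Qed.

Lemma c_count_from (n d : nat) (a : int) :
  c n d a = count_from true n d a + count_from false n d a.
Proof. by rewrite c_count (count_by_head _ true). Qed.

(** Prepending [x] creates a succession exactly when the old first part has the parity of [x], which
    separates the two terms. *)
Lemma count_cons (b : bool) (x n d : nat) (a : int) :
  count (fun s => succs_from b a (x :: s)) (compositions n d.+1) =
  if odd x == b then
    count_from b n d.+1 (a - 1)%R + count_from (~~ b) n d.+1 a
  else 0.
Proof.
case: (eqVneq (odd x) b) => [xb|/negbTE xb]; last first.
  by rewrite -(count_pred0 (compositions n d.+1)); apply: eq_count => s;
    rewrite /succs_from /= xb.
(* Tails have [d.+1] parts, so the empty list is excluded and the head is a genuine part. *)
rewrite (count_by_head _ b); congr (_ + _); apply: eq_in_count => -[|y s];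
  rewrite mem_compositions ?andbF // => _;
  rewrite /succs_from parity_successions_cons2 /= xb eqxx /=;
  case: (odd y); case: (b) => //=; lia.
Qed.

(** Here [m] is what remains of [n.+2] once the first part, 1 if [b] and 2 otherwise, is deleted. *)
Lemma count_from_rec (b : bool) (n d : nat) (a : int) :
  let m := if b then n.+1 else n in
  count_from b n.+2 d.+2 a =
  count_from b n d.+2 a
  + (count_from b m d.+1 (a - 1)%R + count_from (~~ b) m d.+1 a).
Proof.
rewrite {1}/count_from count_compositions_add2 => [|x [|y s]]; last first.
- by rewrite /succs_from !parity_successions_cons2 /= negbK.
- by rewrite /succs_from /= negbK.
rewrite !count_cons -/(count_from b n d.+2 a).
by case: b; rewrite ?addn0 addnC.
Qed.

Theorem theorem5 (n d : nat) (a : int) :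
  (4 <= n)%N -> (3 <= d)%N -> (0 <= a)%R ->
  ((c n d a)%:Z =
     (c (n - 1) (d - 1) (a - 1))%:Z + 2 * (c (n - 2) d a)%:Z
     + (c (n - 2) (d - 1) (a - 1))%:Z + (c (n - 3) (d - 2) a)%:Z
     - (c (n - 3) (d - 1) (a - 1))%:Z - (c (n - 3) (d - 2) (a - 2))%:Z
     - (c (n - 4) d a)%:Z - (c (n - 4) (d - 1) (a - 1))%:Z)%R.
Proof.
case: n => [|[|[|[|n]]]] //; case: d => [|[|[|d]]] // _ _ _.
rewrite !subSS !subn0 !c_count_from.
(* [lia] treats the counts as atoms, so their integer arguments must agree syntactically. *)
have aB2 : (a - 1 - 1 = a - 2)%R by lia.
have rec := count_from_rec.
(* With N = n + 4 and D = d + 3, both parities are expanded at (N, D) and (N - 2, D), then E at (N -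
   1, D - 1) and O at (N - 2, D - 1), each for [a] and [a - 1]. *)
have := (rec true n.+2 d.+1 a, rec false n.+2 d.+1 a).
have := (rec true n d.+1 a, rec false n d.+1 a).
have := (rec false n.+1 d a, rec false n.+1 d (a - 1)%R).
have := (rec true n d a, rec true n d (a - 1)%R).
rewrite /= aB2 => -[? ?] [? ?] [? ?] [? ?]; lia.
Qed.
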